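(* Consider a point on a moving-wall boundary face $f$ normal to the reference direction $\xi_l$, with mapping Jacobian $J>0$, metric terms $\mathcal{M}_l^m=J\,\partial\xi_l/\partial x_m$ ($m=1,2,3$), not all zero, and arbitrary grid velocity $\mathbf{V}_f\in\mathbb{R}^3$, equal to the wall velocity. Let $\mathbf{v}_f^-=(\rho_f^-,\mathbf{u}_f^-,T_f^-)$ be the interior primitive state, $\rho_f^->0$, $T_f^->0$, $\mathbf{u}_f^-\in\mathbb{R}^3$, and let the manufactured viscous boundary state be $$\mathbf{v}_f^{B,\mathrm{V}}=\left(\rho_f^-,\ 2\mathbf{V}_f-\mathbf{u}_f^-,\ T_f^-\right).$$ Let $\mathbf{w}_f^-=\mathbf{w}(\mathbf{v}_f^-)$ and $\mathbf{w}_f^{B,\mathrm{V}}=\mathbf{w}(\mathbf{v}_f^{B,\mathrm{V}})$ be the corresponding entropy variables. For $\sigma_f>0$ define $$\mathbf{L}_f=-\frac{\sigma_f}{2}\left[\widehat{\mathbf{C}}_{ll}(\mathbf{v}_f^-)+\widehat{\mathbf{C}}_{ll}(\mathbf{v}_f^{B,\mathrm{V}})\right],\qquad \mathbf{M}_f^{(\mathrm{B,V})}=\mathbf{L}_f\left(\mathbf{w}_f^--\mathbf{w}_f^{B,\mathrm{V}}\right),$$ where $\widehat{\mathbf{C}}_{ll}(\mathbf{v})=J^{-1}\sum_{m,j=1}^3\mathcal{M}_l^m\,\mathbf{C}_{mj}(\mathbf{v})\,\mathcal{M}_l^j$ is the mapped viscous matrix (no sum over $l$), both evaluations using the same $J$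 and $\mathcal{M}_l^m$. Then the viscous wall penalty $\mathbf{M}_f^{(\mathrm{B,V})}$ is entropy dissipative, i.e. $$(\mathbf{w}_f^-)^\top\mathbf{M}_f^{(\mathrm{B,V})}\le 0 .$$
   Context: Gas model. $R>0$, $\gamma>1$, $c_p=\gamma R/(\gamma-1)$. For a primitive state $\mathbf{v}=(\rho,\mathbf{u},T)$ with $\rho,T>0$: specific total enthalpy $H=c_pT+\frac12|\mathbf{u}|^2$; thermodynamic entropy $s=\frac{R}{\gamma-1}\log(T/T_\infty)-R\log(\rho/\rho_\infty)$ with constants $T_\infty,\rho_\infty>0$; entropy variables $\mathbf{w}(\mathbf{v})=\left(\frac{H-|\mathbf{u}|^2}{T}-s,\ \frac{u_1}{T},\frac{u_2}{T},\frac{u_3}{T},\ -\frac1T\right)^\top$. The map $\mathbf{v}\mapsto\mathbf{w}(\mathbf{v})$ is a smooth bijection onto its image with invertible Jacobian matrix. Viscous matrices. The compressible Navier--Stokes viscous flux in direction $x_m$ is $$\mathbf{F}^{(V)}_{x_m}=\Big(0,\tau_{1m},\tau_{2m},\tau_{3m},\ \sum_{i=1}^3\tau_{im}u_i+\kappa\frac{\partial T}{\partial x_m}\Big)^\top,\qquad \tau_{ij}=\mu\Big(\frac{\partial u_i}{\partial x_j}+\frac{\partial u_j}{\partial x_i}-\frac23\delta_{ij}\sum_{n=1}^3\frac{\partial u_n}{\partial x_n}\Big),$$ with dynamic viscosity $\mu=\mu(T)>0$ and thermal conductivity $\kappa=\kappa(T)>0$. The $5\times5$ matrices $\mathbf{C}_{mj}(\mathbf{v})$,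 $m,j\in\{1,2,3\}$, are the (unique) matrices depending only on the state $\mathbf{v}$ such that $$\mathbf{F}^{(V)}_{x_m}=\sum_{j=1}^3\mathbf{C}_{mj}(\mathbf{v})\frac{\partial\mathbf{w}}{\partial x_j},\qquad m=1,2,3,$$ for all values of the gradients, where $\frac{\partial\mathbf{w}}{\partial x_j}=\frac{\partial\mathbf{w}}{\partial\mathbf{v}}\frac{\partial\mathbf{v}}{\partial x_j}$. The block matrix $(\mathbf{C}_{mj})_{m,j}$ is symmetric positive semi-definite. The quantity $(\mathbf{w}_f^-)^\top\mathbf{M}_f^{(\mathrm{B,V})}$ is the pointwise contribution of the penalty to the rate of change of the discrete total mathematical entropy $-\rho s$; ''entropy dissipative'' means that it is non-positive. *)

(* Defs.v *)
From HB Require Import structures.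
From mathcomp Require Import all_boot all_order all_algebra.
From mathcomp Require Import all_classical all_reals all_analysis.
Set Implicit Arguments.
Unset Strict Implicit.
Unset Printing Implicit Defensive.
Import Order.TTheory GRing.Theory Num.Theory.
Import numFieldNormedType.Exports.
Local Open Scope ring_scope.

(* Five-component vectors are stored as rows because the library's [jacobian]
   is defined for maps between row vectors; the column vectors of the
   mathematics are their transposes.  Components: 0 is the density slot,
   1, 2, 3 the velocity slots, 4 the temperature/energy slot. *)
Definition vec5 (R : realType) (a : R) (b : 'rV[R]_3) (c : R) : 'rV[R]_5 :=
  \row_(k < 5) [:: a; b 0 0; b 0 1; b 0 2%:R; c]`_k.

Definition dens (R : realType) (v : 'rV[R]_5) : R := v 0 ord0.
Definition vel (R : realType) (v : 'rV[R]_5) : 'rV[R]_3 :=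
  \row_(i < 3) v 0 (inord i.+1).
Definition temp (R : realType) (v : 'rV[R]_5) : R := v 0 ord_max.

Definition admissible (R : realType) (v : 'rV[R]_5) : Prop :=
  0 < dens v /\ 0 < temp v.

Record gas (R : realType) := Gas {
  gas_constant : R;
  gas_gamma : R;
  T_infty : R;
  rho_infty : R;
  viscosity : R -> R;
  conductivity : R -> R;
  gas_constant_gt0 : 0 < gas_constant;
  gas_gamma_gt1 : 1 < gas_gamma;
  T_infty_gt0 : 0 < T_infty;
  rho_infty_gt0 : 0 < rho_infty;
  viscosity_gt0 : forall T, 0 < T -> 0 < viscosity T;
  conductivity_gt0 : forall T, 0 < T -> 0 < conductivity T
}.

Definition c_p (R : realType) (g : gas R) : R :=
  gas_gamma g * gas_constant g / (gas_gamma g - 1).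

Definition normsq (R : realType) (u : 'rV[R]_3) : R := \sum_(i < 3) u 0 i ^+ 2.

Definition total_enthalpy (R : realType) (g : gas R) (v : 'rV[R]_5) : R :=
  c_p g * temp v + 2^-1 * normsq (vel v).

Definition entropy (R : realType) (g : gas R) (v : 'rV[R]_5) : R :=
  gas_constant g / (gas_gamma g - 1) * ln (temp v / T_infty g)
  - gas_constant g * ln (dens v / rho_infty g).

Definition entropy_vars (R : realType) (g : gas R) (v : 'rV[R]_5) : 'rV[R]_5 :=
  vec5 ((total_enthalpy g v - normsq (vel v)) / temp v - entropy g v)
       ((temp v)^-1 *: vel v)
       (- (temp v)^-1).

(* The library's [jacobian f p] acts on row vectors from the right, so the
   usual matrix of partial derivatives (dw_i / dv_k)_(i, k) is its transpose. *)
Definition dw_dv (R : realType) (g : gas R) (v : 'rV[R]_5) : 'M[R]_5 :=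
  (jacobian (entropy_vars g) v)^T.

(* Below, [dv j] stands for the gradient component dv/dx_j, so that
   [vel (dv j) 0 i] is du_i/dx_j and [temp (dv j)] is dT/dx_j. *)
Definition stress (R : realType) (g : gas R) (v : 'rV[R]_5)
    (dv : 'I_3 -> 'rV[R]_5) (i j : 'I_3) : R :=
  viscosity g (temp v) *
  (vel (dv j) 0 i + vel (dv i) 0 j
   - 2 / 3 * (i == j)%:R * \sum_(n < 3) vel (dv n) 0 n).

Definition viscous_flux (R : realType) (g : gas R) (v : 'rV[R]_5)
    (dv : 'I_3 -> 'rV[R]_5) (m : 'I_3) : 'rV[R]_5 :=
  vec5 0
       (\row_(i < 3) stress g v dv i m)
       (\sum_(i < 3) stress g v dv i m * vel v 0 i
        + conductivity g (temp v) * temp (dv m)).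

(* The defining property of the matrices C_mj; since [dw_dv g v] is invertible
   at admissible states, it determines [C m j v] there. *)
Definition viscous_matrices (R : realType) (g : gas R)
    (C : 'I_3 -> 'I_3 -> 'rV[R]_5 -> 'M[R]_5) : Prop :=
  forall v, admissible v -> forall (dv : 'I_3 -> 'rV[R]_5) (m : 'I_3),
    (viscous_flux g v dv m)^T
    = \sum_(j < 3) C m j v *m (dw_dv g v *m (dv j)^T).

(* [dxi l m] stands for dxi_l/dx_m at the boundary point. *)
Definition metric_term (R : realType) (J : R) (dxi : 'M[R]_3) (l m : 'I_3) : R :=
  J * dxi l m.

Definition mapped_viscous (R : realType)
    (C : 'I_3 -> 'I_3 -> 'rV[R]_5 -> 'M[R]_5) (J : R) (dxi : 'M[R]_3)
    (l : 'I_3) (v : 'rV[R]_5) : 'M[R]_5 :=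
  J^-1 *: \sum_(m < 3) \sum_(j < 3)
    (metric_term J dxi l m * metric_term J dxi l j) *: C m j v.

Definition wall_state (R : realType) (V : 'rV[R]_3) (v : 'rV[R]_5) : 'rV[R]_5 :=
  vec5 (dens v) (2 *: V - vel v) (temp v).

Definition penalty_matrix (R : realType)
    (C : 'I_3 -> 'I_3 -> 'rV[R]_5 -> 'M[R]_5) (J : R) (dxi : 'M[R]_3)
    (l : 'I_3) (sigma : R) (v vB : 'rV[R]_5) : 'M[R]_5 :=
  - (sigma / 2) *: (mapped_viscous C J dxi l v + mapped_viscous C J dxi l vB).

Definition wall_penalty (R : realType) (g : gas R)
    (C : 'I_3 -> 'I_3 -> 'rV[R]_5 -> 'M[R]_5) (J : R) (dxi : 'M[R]_3)
    (l : 'I_3) (sigma : R) (V : 'rV[R]_3) (v : 'rV[R]_5) : 'cV[R]_5 :=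
  penalty_matrix C J dxi l sigma v (wall_state V v)
  *m (entropy_vars g v - entropy_vars g (wall_state V v))^T.

(* Main.v *)
From HB Require Import structures.
Require Import Defs.
From mathcomp Require Import all_boot all_order all_algebra.
From mathcomp Require Import all_classical all_reals all_analysis.
From mathcomp Require Import ring.
Import Order.TTheory GRing.Theory Num.Theory.
Import numFieldNormedType.Exports.
Local Open Scope ring_scope.

(* Both states share the density and the temperature, so the jump of the entropy
   variables is (a, b, 0) with b = (u - uB) / T.  A vector (a, b, 0) has no
   temperature component: applied to it, the normally contracted viscous matrix
   at a state with velocity u' gives T mu (0, t, t.u') with
   t = |n|^2 b + (n.b) n / 3.  Pairing with w = (_, u / T, - 1 / T), the interior
   matrix contributes 0 and the boundary one mu t.(u - uB) = T mu t.b, which is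
   nonnegative because t.b = |n|^2 |b|^2 + (n.b)^2 / 3. *)

Lemma sum3E (V : nmodType) (F : 'I_3 -> V) :
  \sum_(i < 3) F i = F 0 + F 1 + F 2%:R.
Proof.
rewrite !big_ord_recl big_ord0 addr0 addrA.
by congr (F _ + F _ + F _); apply/val_inj.
Qed.

Lemma row3P {R : realType} (a b : 'rV[R]_3) :
  a 0 0 = b 0 0 -> a 0 1 = b 0 1 -> a 0 2%:R = b 0 2%:R -> a = b.
Proof.
move=> e0 e1 e2; apply/rowP => -[[|[|[|//]]] lti].
- by rewrite (_ : Ordinal lti = 0) //; apply/val_inj.
- by rewrite (_ : Ordinal lti = 1) //; apply/val_inj.
- by rewrite (_ : Ordinal lti = 2%:R) //; apply/val_inj.
Qed.

Lemma dens_vec5 {R : realType} (a : R) b c : dens (vec5 a b c) = a.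
Proof. by rewrite /dens mxE. Qed.

Lemma vel_vec5 {R : realType} (a : R) b c : vel (vec5 a b c) = b.
Proof. by apply: row3P; rewrite !mxE inordK. Qed.

Lemma temp_vec5 {R : realType} (a : R) b c : temp (vec5 a b c) = c.
Proof. by rewrite /temp mxE. Qed.

Lemma dot_vec5 {R : realType} (a a' : R) b b' c c' :
  (vec5 a b c *m (vec5 a' b' c')^T) 0 0 =
  a * a' + \sum_i b 0 i * b' 0 i + c * c'.
Proof.
by rewrite sum3E mxE !big_ord_recl big_ord0 !mxE /= addr0 !addrA.
Qed.

Lemma vec5D {R : realType} (a a' : R) b b' c c' :
  vec5 a b c + vec5 a' b' c' = vec5 (a + a') (b + b') (c + c').
Proof.
by apply/rowP => -[[|[|[|[|[|//]]]]] lti]; rewrite !mxE.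
Qed.

Lemma vec5Z {R : realType} (k a : R) b c :
  k *: vec5 a b c = vec5 (k * a) (k *: b) (k * c).
Proof.
by apply/rowP => -[[|[|[|[|[|//]]]]] lti]; rewrite !mxE.
Qed.

(** Declared as an instance so that class inference can differentiate finite sums. *)
#[local] Instance is_diff_sum {R : numFieldType} (V W : normedModType R) n
  (f df : 'I_n -> V -> W) (x : V) :
  (forall i, is_diff x (f i) (df i)) ->
  is_diff x (\sum_(i < n) f i) (\sum_(i < n) df i).
Proof.
move=> h; elim/big_ind2 : _ => // [|*]; [exact: is_diff_cst|exact: is_diffD].
Qed.

#[local] Instance is_diff_coord {R : realType} m n (M : 'M[R]_(m, n)) i j :
  is_diff M (fun N : 'M[R]_(m, n) => N i j : R) (fun N => N i j).
Proof.
have lin : linear (fun N : 'M[R]_(m, n) => N i j : R^o).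
  by move=> a u v; rewrite !mxE.
pose fM := GRing.isLinear.Build _ _ _ _ _ lin.
pose f : {linear 'M[R]_(m, n) -> R^o} :=
  HB.pack (fun N : 'M[R]_(m, n) => N i j : R^o) fM.
apply: DiffDef; first exact: differentiable_coord.
by rewrite (@diff_lin _ _ _ f)//; exact: coord_continuous.
Qed.

(** A row is the sum of its entries times the basis rows [delta_mx 0 i], which reduces the claim to
    the entries. *)
Lemma is_diff_row {R : realType} (V : normedModType R) n
    (f df : 'I_n -> V -> R) (x : V) :
  (forall k, is_diff x (f k) (df k)) ->
  is_diff x (fun y => \row_k f k y) (fun y => \row_k df k y).
Proof.
move=> h.
have rowE (k : 'I_n -> V -> R) : (fun y => \row_i k i y) =
    \sum_i (( *:%R ^~ (delta_mx 0 i : 'rV[R]_n)) \o k i).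
  apply/funext => y; rewrite fct_sumE [LHS]row_sum_delta.
  by apply: eq_bigr => i _; rewrite mxE.
by rewrite !rowE; apply: is_diff_sum => i; apply: is_diff_comp.
Qed.

Lemma is_diff_ln {R : realType} {x : R} : 0 < x ->
  is_diff x (@ln R) (fun h => h * x^-1).
Proof.
move=> x0; have [dln eln] := is_derive1_ln x0.
have dfx : differentiable (@ln R) x by exact/derivable1_diffP.
by apply: DiffDef => //; rewrite diff1E// derive1E eln.
Qed.

Lemma is_diff_inv {R : realType} {x : R} : x != 0 ->
  is_diff x (@GRing.inv R) (fun h => - x ^- 2 * h).
Proof.
by move=> x0; apply: DiffDef; [exact: differentiable_Rinv|rewrite diff_Rinv].
Qed.

(** The differential of the entropy variables at [v] in direction [z]. The first slot is the
    quotient rule for [(H - |u|^2) / T], with [d(H - |u|^2) = c_p dT - u . du], minus [ds]. *)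
Definition entropy_vars_diff {R : realType} (g : gas R) (v z : 'rV[R]_5) :
    'rV[R]_5 :=
  let du := \sum_i vel v 0 i * vel z 0 i in
  vec5 ((c_p g * temp z - du) / temp v
          - (total_enthalpy g v - normsq (vel v)) * temp z / temp v ^+ 2
        - (gas_constant g / (gas_gamma g - 1) * (temp z / temp v)
           - gas_constant g * (dens z / dens v)))
       ((temp v)^-1 *: vel z - (temp z / temp v ^+ 2) *: vel v)
       (temp z / temp v ^+ 2).

Lemma is_diff_entropy_vars {R : realType} (g : gas R) {v : 'rV[R]_5} :
  admissible v ->
  is_diff v (entropy_vars g) (entropy_vars_diff g v).
Proof.
case=> rho_gt0 T_gt0.
have T0 : temp v != 0 by rewrite gt_eqF.
have rho0 : dens v != 0 by rewrite gt_eqF.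
(* The [is_diff] facts kept in the context act as local instances: once a slot is written with
   operations on functions, class inference produces its differential. *)
have dT : is_diff v (@temp R) (@temp R) by exact: is_diff_coord.
have drho : is_diff v (@dens R) (@dens R) by exact: is_diff_coord.
have du i : is_diff v (fun y => vel y 0 i) (fun y => vel y 0 i).
  rewrite (_ : (fun y => _) = fun y : 'rV[R]_5 => y 0 (inord i.+1)).
    exact: is_diff_coord.
  by apply/funext => y; rewrite mxE.
have dq : is_diff v (fun y => normsq (vel y))
    (fun z => 2 * \sum_i vel v 0 i * vel z 0 i).
  rewrite (_ : (fun y => _) = \sum_i ((fun y => vel y 0 i) ^+ 2)); last first.
    by apply/funext => y; rewrite fct_sumE.
  apply: is_diff_eq; apply/funext => z; rewrite fct_sumE mulr_sumr.
  by apply: eq_bigr => i _; rewrite mulrA expr1.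
have dV := is_diff_inv T0.
have diT : is_diff v (GRing.inv \o @temp R)
    (fun z => - temp v ^- 2 * temp z) by exact: is_diff_comp.
(* The reference value cancels: [(f z / c) / (f v / c) = f z / f v]. *)
have dln (f : 'rV[R]_5 -> R) (c : R) : is_diff v f f -> 0 < f v -> 0 < c ->
    is_diff v (fun y => ln (f y / c)) (fun z => f z / f v).
  move=> df fv0 c0; have dl := is_diff_ln (divr_gt0 fv0 c0).
  have -> : (fun y => ln (f y / c)) = @ln R \o (c^-1 *: f).
    by apply/funext => y /=; rewrite mulrC.
  have dl' : is_diff ((c^-1 *: f) v) (@ln R) (fun h => h * (f v / c)^-1).
    by rewrite (_ : (c^-1 *: f) v = f v / c)// mulrC.
  apply: is_diff_eq; apply/funext => z /=.
  rewrite [in LHS]/(c^-1 *: f)/= /GRing.scale/=.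
  by field; rewrite !gt_eqF.
have dlT := dln _ _ dT T_gt0 (T_infty_gt0 g).
have dlrho := dln _ _ drho rho_gt0 (rho_infty_gt0 g).
have dw i : is_diff v (fun y => ((temp y)^-1 *: vel y) 0 i)
    (fun y => ((temp v)^-1 *: vel y - (temp y / temp v ^+ 2) *: vel v) 0 i).
  rewrite (_ : (fun y => _) = (GRing.inv \o @temp R) * (fun y => vel y 0 i)).
    apply: is_diff_eq; apply/funext => z.
    rewrite !fctE !mxE /GRing.scale/=.
    by field.
  by apply/funext => y; rewrite mxE.
pose q := fun y : 'rV[R]_5 => normsq (vel y).
rewrite /entropy_vars /entropy_vars_diff /vec5.
apply: is_diff_row => -[[|[|[|[|[|//]]]]] /= _].
- rewrite /entropy /total_enthalpy.
  rewrite (_ : (fun y => _) =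
     (c_p g *: @temp R + 2^-1 *: q - q) * (GRing.inv \o @temp R)
     - ((gas_constant g / (gas_gamma g - 1)) *:
          (fun y => ln (temp y / T_infty g))
        - gas_constant g *: (fun y => ln (dens y / rho_infty g)))) //.
  apply: is_diff_eq; apply/funext => z.
  rewrite !fctE /q /GRing.scale /=.
  congr (_ - _).
  move: (\sum_(i < 3) _) (normsq _) => a b.
  by field.
- exact: dw.
- exact: dw.
- exact: dw.
- rewrite (_ : (fun y => _) = - (GRing.inv \o @temp R)) //.
  apply: is_diff_eq; apply/funext => z; rewrite !fctE.
  by field.
Qed.

(** Trades the Jacobian for the closed form, so that neither its entries nor its inverse are
    computed. *)
Lemma dw_dv_mul {R : realType} (g : gas R) (v z : 'rV[R]_5) :
  admissible v -> dw_dv g v *m z^T = (entropy_vars_diff g v z)^T.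
Proof.
move=> /(is_diff_entropy_vars g) [dw edw].
by rewrite /dw_dv -trmx_mul -deriveEjacobian// deriveE// edw.
Qed.

(* Viscous traction, at unit viscosity, on the plane with normal [n] for the
   velocity gradient du_i/dx_j = b_i n_j. *)
Definition normal_traction {R : realType} (n b : 'rV[R]_3) : 'rV[R]_3 :=
  normsq n *: b + (3^-1 * \sum_i n 0 i * b 0 i) *: n.

(** The defining property of [C] is applied to the gradients [n 0 j *: z], where [z] is a preimage
    of [(a, b, 0)] under [dw_dv g v]. The contracted matrix then returns the viscous flux through
    the plane with normal [n]. *)
Lemma viscous_matrices_normal {R : realType} (g : gas R)
    (C : 'I_3 -> 'I_3 -> 'rV[R]_5 -> 'M[R]_5) (n : 'rV[R]_3) (v : 'rV[R]_5)
    (a : R) (b : 'rV[R]_3) :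
  viscous_matrices g C -> admissible v ->
  (\sum_m \sum_j (n 0 m * n 0 j) *: C m j v) *m (vec5 a b 0)^T =
  (temp v * viscosity g (temp v)) *:
    (vec5 0 (normal_traction n b)
       (\sum_i normal_traction n b 0 i * vel v 0 i))^T.
Proof.
move=> hC adm; have [rho_gt0 T_gt0] := adm.
have T0 : temp v != 0 by rewrite gt_eqF.
have rho0 : dens v != 0 by rewrite gt_eqF.
have Rg0 : gas_constant g != 0 by rewrite gt_eqF// gas_constant_gt0.
(* Solved from the last slot upwards: [dT = 0], then [du = T b], then [R drho / rho - u . b = a]. *)
pose z := vec5 (dens v / gas_constant g * (a + \sum_i vel v 0 i * b 0 i))
               (temp v *: b) 0.
have dwz : entropy_vars_diff g v z = vec5 a b 0.
  rewrite /entropy_vars_diff dens_vec5 vel_vec5 temp_vec5; congr vec5.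
  - under eq_bigr => i _ do rewrite [X in _ * X]mxE mulrCA.
    rewrite -mulr_sumr; move: (\sum_(i < 3) _) => s.
    rewrite !mulr0 !mul0r mulr0.
    by field; rewrite T0 Rg0 rho0.
  - by rewrite mul0r scale0r subr0 scalerA mulVf// scale1r.
  - by rewrite mul0r.
pose dz (j : 'I_3) := n 0 j *: z.
have stressE i j : stress g v dz i j = viscosity g (temp v) * temp v *
    (n 0 j * b 0 i + n 0 i * b 0 j
     - 2 / 3 * (i == j)%:R * \sum_k n 0 k * b 0 k).
  rewrite /stress /dz /z !sum3E !vec5Z !vel_vec5 !mxE.
  by field.
transitivity (\sum_m n 0 m *: (viscous_flux g v dz m)^T).
  rewrite mulmx_suml; apply: eq_bigr => m _; rewrite (hC _ adm) scaler_sumr.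
  rewrite mulmx_suml; apply: eq_bigr => j _.
  by rewrite linearZ/= -!scalemxAr dw_dv_mul// dwz -scalemxAl scalerA.
(* Without a temperature gradient the heat flux vanishes, and only the work of the stress remains in
   the energy slot. *)
have tempE j : temp (dz j) = 0 by rewrite /dz /z vec5Z temp_vec5 mulr0.
rewrite -linearZ/= !sum3E -!linearZ -!linearD /= /viscous_flux.
rewrite !vec5Z !vec5D !tempE.
congr (_^T); clearbody dz.
move: (vel v) (viscosity g _) stressE => u mu stressE.
congr vec5.
- by ring.
(* The coefficient [1/3] of [(n . b) n] is [1 - 2/3]: the transposed gradient minus the trace
   term. *)
- apply: row3P; rewrite /normal_traction /normsq;
  by rewrite !(mxE, stressE) !sum3E /=; field.
- by rewrite /normal_traction /normsq !sum3E !(mxE, stressE) !sum3E /=; field.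
Qed.

Lemma normal_traction_ge0 {R : realType} (n b : 'rV[R]_3) :
  0 <= \sum_i b 0 i * normal_traction n b 0 i.
Proof.
have -> : \sum_i b 0 i * normal_traction n b 0 i =
    normsq n * normsq b + 3^-1 * (\sum_i n 0 i * b 0 i) ^+ 2.
  rewrite /normal_traction /normsq; under eq_bigr => i _ do rewrite !mxE.
  by rewrite !sum3E; field.
have normsq_ge0 (w : 'rV[R]_3) : 0 <= normsq w.
  by apply: sumr_ge0 => i _; exact: sqr_ge0.
by rewrite addr_ge0 // mulr_ge0 ?normsq_ge0 ?sqr_ge0 ?invr_ge0 ?ler0n.
Qed.

Theorem theorem4p3 (R : realType) (g : gas R)
    (C : 'I_3 -> 'I_3 -> 'rV[R]_5 -> 'M[R]_5)
    (C_viscous : viscous_matrices g C)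
    (l : 'I_3) (J : R) (J_gt0 : 0 < J)
    (dxi : 'M[R]_3) (metric_neq0 : exists m : 'I_3, metric_term J dxi l m != 0)
    (V : 'rV[R]_3)
    (rho : R) (u : 'rV[R]_3) (T : R) (rho_gt0 : 0 < rho) (T_gt0 : 0 < T)
    (sigma : R) (sigma_gt0 : 0 < sigma) :
  (entropy_vars g (vec5 rho u T)
   *m wall_penalty g C J dxi l sigma V (vec5 rho u T)) 0 0 <= 0.
Proof.
set v := vec5 rho u T; pose vB := wall_state V v.
pose uB := 2 *: V - u; pose b := T^-1 *: (u - uB).
pose n : 'rV[R]_3 := \row_m metric_term J dxi l m.
have vBE : vB = vec5 rho uB T.
  by rewrite /vB /wall_state dens_vec5 vel_vec5 temp_vec5.
have adm : admissible v by rewrite /admissible dens_vec5 temp_vec5.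
have admB : admissible vB by rewrite vBE /admissible dens_vec5 temp_vec5.
(* The value of [a] can stay implicit: the right-hand side of [viscous_matrices_normal] does not
   depend on it. *)
have [a dwE] : exists a, entropy_vars g v - entropy_vars g vB = vec5 a b 0.
  rewrite vBE -[- entropy_vars _ _]scaleN1r /entropy_vars !vec5Z !vec5D.
  rewrite !vel_vec5 !temp_vec5; eexists; congr vec5.
  - by rewrite [RHS]scalerBr scaleN1r.
  - by rewrite mulN1r subrr.
have mappedE y : mapped_viscous C J dxi l y =
    J^-1 *: \sum_m \sum_j (n 0 m * n 0 j) *: C m j y.
  rewrite /mapped_viscous; congr (_ *: _); apply: eq_bigr => m _.
  by apply: eq_bigr => j _; rewrite !mxE.
pose t := normal_traction n b; pose s := \sum_i b 0 i * t 0 i.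
have s_ge0 : 0 <= s by exact: normal_traction_ge0.
rewrite /wall_penalty /penalty_matrix -/vB dwE !mappedE -scalerDr scalerA.
rewrite -scalemxAl mulmxDl !(viscous_matrices_normal g)//.
(* Equal temperatures give both states the same factor [T * viscosity g T], so the two images add up
   to a multiple of [(0, 2 t, t . (u + uB))]. *)
rewrite vBE !temp_vec5 !vel_vec5 -scalerDr -linearD vec5D scalerA.
rewrite -scalemxAr mxE dot_vec5 temp_vec5 vel_vec5 -/t.
(* The pairing is [(2 t . u - t . (u + uB)) / T = t . (u - uB) / T = t . b]. *)
rewrite [X in _ * X](_ : _ = s); last first.
  by rewrite /s !sum3E !mxE; field; rewrite gt_eqF.
have k_gt0 := viscosity_gt0 g T_gt0.
by rewrite !mulNr oppr_le0 !mulr_ge0// ?invr_ge0// ltW.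
Qed.
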